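(* Let $X$ be a unimodular Lie group with Haar measure $\mu$. Let $1\le a_1<b_1\le\infty$ and $1\le a_2<b_2\le\infty$ with $1/a_1+1/a_2>1$ and $1/b_1+1/b_2>1$, let $\psi_1,\psi_2$ be admissible weights on $(a_1,b_1)$ and $(a_2,b_2)$ respectively, and let $f\in G(\psi_1;a_1,b_1)$ and $g\in G(\psi_2;a_2,b_2)$. Put $$A_3=\frac{a_1a_2}{a_1+a_2-a_1a_2},\qquad B_3=\frac{b_1b_2}{b_1+b_2-b_1b_2},$$ and for $r\in(A_3,B_3)$ $$\tau(r)=\inf\left\{\psi_1(p)\,\psi_2(q):\ p,q>1,\ \frac1p+\frac1q=1+\frac1r\right\}.$$ Then $$\|f*g\|_{G(\tau;A_3,B_3)}\le\|f\|_{G(\psi_1;a_1,b_1)}\,\|g\|_{G(\psi_2;a_2,b_2)}.$$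
   Context: The generalized convolution is $(f*g)(x)=\int_X g(xy^{-1})f(y)\,\mu(dy)$. Unimodularity means that the Haar measure $\mu$ is both left and right invariant. For $1\le a<b\le\infty$, an admissible weight on $(a,b)$ is a continuous, positive, log-convex function $\psi:(a,b)\to(0,\infty)$ such that the limits $\psi(a+0)$ and $\psi(b-0)$ exist (possibly $+\infty$), $\max(\psi(a+0),\psi(b-0))=\infty$ and $\min(\psi(a+0),\psi(b-0))>0$. For a positive function $\psi$ on $(a,b)$, the space $G(\psi;a,b)$ consists of all measurable $h:X\to\mathbb{R}$ with finite norm $\|h\|_{G(\psi;a,b)}=\sup_{p\in(a,b)}|h|_p/\psi(p)$, where $|h|_p=\left(\int_X|h|^p\,d\mu\right)^{1/p}$. The same formula defines the norm with weight $\tau$. The infimum defining $\tau(r)$ is over those $p,q$ for which the expressions are defined, i.e. $p\in(a_1,b_1)$ and $q\in(a_2,b_2)$. *)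

(* Defs.v *)
From HB Require Import structures.
From mathcomp Require Import all_boot all_order all_algebra monoid.
From mathcomp Require Import all_classical all_reals all_analysis.
Import Order.TTheory GRing.Theory Num.Theory.
Import numFieldNormedType.Exports.

Set Implicit Arguments.
Unset Strict Implicit.
Unset Printing Implicit Defensive.

Local Open Scope classical_set_scope.
Local Open Scope ring_scope.

(* [U] is meant to be open, so that continuity and directional derivatives at
   its points do not involve the values of [f] outside [U]. *)
Fixpoint Cdiff (R : realType) (m k : nat) (U : set 'rV[R]_m)
    (f : 'rV[R]_m -> R) : Prop :=
  (forall x, U x -> {for x, continuous f}) /\
  if k is k'.+1 then
    forall i : 'I_m, (forall x, U x -> derivable f x (delta_mx 0 i)) /\
                     Cdiff k' U ('D_(delta_mx 0 i) f)
  else True.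

Definition smooth_on (R : realType) (m n : nat) (U : set 'rV[R]_m)
    (f : 'rV[R]_m -> 'rV[R]_n) : Prop :=
  forall (k : nat) (j : 'I_n), Cdiff k U (fun x => f x 0 j).

(* A homeomorphism between an open subset of [X] and an open subset of R^n;
   [chart_map] and [chart_inv] are arbitrary outside these subsets. *)
Record chart (R : realType) (n : nat) (X : topologicalType) := Chart {
  chart_dom : set X;
  chart_cod : set 'rV[R]_n;
  chart_map : X -> 'rV[R]_n;
  chart_inv : 'rV[R]_n -> X;
  chart_dom_open : open chart_dom;
  chart_cod_open : open chart_cod;
  chart_map_cod : forall x, chart_dom x -> chart_cod (chart_map x);
  chart_inv_dom : forall v, chart_cod v -> chart_dom (chart_inv v);
  chart_mapK : forall x, chart_dom x -> chart_inv (chart_map x) = x;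
  chart_invK : forall v, chart_cod v -> chart_map (chart_inv v) = v;
  chart_map_cts : forall x, chart_dom x -> {for x, continuous chart_map};
  chart_inv_cts : forall v, chart_cod v -> {for v, continuous chart_inv} }.

(* The point of the pointed structure plays no role; it is required by the
   measurable structure on generated sigma-algebras. *)
HB.mixin Record isLieGroup (R : realType) (n : nat) X
    of Group X & PointedTopological X := {
  lie_atlas : set (chart R n X);
  lie_hausdorff : hausdorff_space X;
  lie_second_countable : @second_countable X;
  lie_atlas_cover : forall x : X, exists2 c, lie_atlas c & chart_dom c x;
  lie_atlas_compat : forall c c', lie_atlas c -> lie_atlas c' ->
    smooth_on (chart_cod c `&` chart_inv c @^-1` chart_dom c')
              (chart_map c' \o chart_inv c);
  lie_mul_cts : continuous (fun z : X * X => (z.1 * z.2)%g);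
  lie_inv_cts : continuous (fun x : X => (x^-1)%g);
  lie_mul_smooth : forall c1 c2 c3,
    lie_atlas c1 -> lie_atlas c2 -> lie_atlas c3 ->
    let mul_inv (v : 'rV[R]_(n + n)) :=
      (chart_inv c1 (lsubmx v) * chart_inv c2 (rsubmx v))%g in
    smooth_on [set v | [/\ chart_cod c1 (lsubmx v), chart_cod c2 (rsubmx v)
                         & chart_dom c3 (mul_inv v)]]
              (chart_map c3 \o mul_inv);
  lie_inv_smooth : forall c c', lie_atlas c -> lie_atlas c' ->
    let inv_inv v := ((chart_inv c v)^-1)%g in
    smooth_on (chart_cod c `&` inv_inv @^-1` chart_dom c')
              (chart_map c' \o inv_inv) }.

#[short(type="lieGroupType")]
HB.structure Definition LieGroup (R : realType) (n : nat) :=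
  {X of isLieGroup R n X & Group X & PointedTopological X}.

Notation borel X := (g_sigma_algebraType (@open X)).

Section lie_group_analysis.
Context (R : realType) (n : nat) (X : lieGroupType R n).
Implicit Types (mu : {measure set (borel X) -> \bar R}) (f g h : X -> R).

Definition left_invariant mu := forall (x : X) (A : set (borel X)),
  measurable A -> mu [set (x * y)%g | y in A] = mu A.

Definition right_invariant mu := forall (x : X) (A : set (borel X)),
  measurable A -> mu [set (y * x)%g | y in A] = mu A.

Definition radon mu :=
  [/\ forall K : set X, compact K -> (mu K < +oo)%E,
      forall A : set (borel X), measurable A ->
        mu A = ereal_inf [set mu U | U in [set U : set X | open U /\ A `<=` U]]
    & forall U : set X, open U ->
        mu U = ereal_sup [set mu K | K in [set K : set X | compact K /\ K `<=` U]]].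

Definition haar mu :=
  [/\ left_invariant mu, radon mu & mu [set: borel X] != 0%E].

Definition unimodular mu := left_invariant mu /\ right_invariant mu.

(* [Rintegral] takes the value 0 wherever the integral of the extended-real
   function is infinite. *)
Definition convolution mu f g (x : X) : R :=
  \int[mu]_(y in [set: borel X]) (g (x * y^-1)%g * f y).

Definition oo_itv (a : R) (b : \bar R) : set R :=
  [set p | a < p /\ (p%:E < b)%E].

(* Punctured left neighborhoods of [b], as a filter on R. *)
Definition left_nbhs (b : \bar R) : set_system R :=
  match b with r%:E => r^'- | +oo%E => +oo | -oo%E => -oo end.

Definition admissible_weight (a : R) (b : \bar R) (psi : R -> R) : Prop :=
  [/\ forall p, oo_itv a b p -> {for p, continuous psi},
      forall p, oo_itv a b p -> 0 < psi p,
      @convex_function R R^o (oo_itv a b) (@ln R \o psi)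
    & exists la lb : \bar R,
      [/\ (psi p)%:E @[p --> a^'+] --> la,
          (psi p)%:E @[p --> left_nbhs b] --> lb,
          maxe la lb = +oo%E & (0 < mine la lb)%E]].

Definition G_norm mu (psi : R -> R) (a : R) (b : \bar R) h : \bar R :=
  ereal_sup [set (Lnorm mu p%:E (EFin \o (h : borel X -> R)) / (psi p)%:E)%E
            | p in oo_itv a b].

Definition G_space mu (psi : R -> R) (a : R) (b : \bar R) : set (X -> R) :=
  [set h | measurable_fun [set: borel X] h /\ (G_norm mu psi a b h < +oo)%E].

End lie_group_analysis.

Definition exponent_A3 (R : realType) (a1 a2 : R) : R :=
  a1 * a2 / (a1 + a2 - a1 * a2).

(* The condition 1 < b1^-1 + b2^-1 with b1, b2 > 1 forces b1 and b2 to be finite,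
   so no indeterminate form occurs where this is used. *)
Definition exponent_B3 (R : realType) (b1 b2 : \bar R) : \bar R :=
  (b1 * b2 / (b1 + b2 - b1 * b2))%E.

Definition tau_weight (R : realType) (a1 a2 : R) (b1 b2 : \bar R) (psi1 psi2 : R -> R)
    (r : R) : R :=
  inf [set s | exists p q, [/\ oo_itv a1 b1 p /\ 1 < p, oo_itv a2 b2 q /\ 1 < q,
                               p^-1 + q^-1 = 1 + r^-1 & s = psi1 p * psi2 q]].

(* Main.v *)
Require Import Defs.
From HB Require Import structures.
From mathcomp Require Import all_boot all_order all_algebra monoid.
From mathcomp Require Import all_classical all_reals all_analysis.
From mathcomp Require Import measurable_realfun measurable_fun_approximation.
From mathcomp Require Import ring lra.
Import Order.TTheory GRing.Theory Num.Theory.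
Import numFieldNormedType.Exports.

(** The estimate is Young's inequality
      |f * g|_r <= |f|_p |g|_q,   1/p + 1/q = 1 + 1/r,
    optimised over p and q. By definition of the norms,
    |f|_p <= ||f|| psi1(p) and |g|_q <= ||g|| psi2(q), so for a fixed r
      |f * g|_r <= ||f|| ||g|| psi1(p) psi2(q)
    for all admissible p and q, and taking the infimum over them gives
    |f * g|_r <= ||f|| ||g|| tau(r). Dividing by tau(r) needs tau(r) > 0, which
    holds because an admissible weight on a bounded interval is bounded away
    from 0 ([admissible_weight_bounded_below]); it also needs the infimum to be
    over a nonempty set, which is what A_3 < r < B_3 means in terms of the
    inverse exponents ([exists_young_exponents]). The condition on b1 and b2
    makes both of them finite.

    Young's inequality comes from a version for kernels, [young_kernel]: if the
    integrals of K(x,y)^q in x and in y are all at most C, then the operator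
    with kernel K maps L^p to L^r with norm at most C^(1/q). This is Hoelder's
    inequality with three factors, applied to
      K F = (K^q F^p)^(1/r) (F^p)^(1 - 1/q) (K^q)^(1 - 1/p),
    followed by Tonelli's theorem. For K(x,y) = |g(x y^-1)| the integral in x is
    |g|_q^q by right invariance; the integral in y is |g|_q^q by left invariance
    and invariance under y -> y^-1. The latter is a property of unimodular
    groups, obtained by computing a double integral in two orders
    ([unimodular_integral_inv]).

    Tonelli's theorem needs a sigma-finite measure and functions measurable for
    the product sigma-algebra. Both come from second countability: an open set
    of a product is a countable union of open rectangles
    ([continuous_measurable_prod]), and a locally finite measure is sigma-finite
    by Lindeloef's argument ([locally_finite_sigma_finite]). Local finiteness
    comes from outer regularity at points ([radon_locally_finite]). *)

Set Implicit Arguments.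
Unset Strict Implicit.
Unset Printing Implicit Defensive.

Local Open Scope classical_set_scope.
Local Open Scope ring_scope.

(** * Young's inequality for integral kernels *)

Lemma lee_poweR (R : realType) (r : R) (x y : \bar R) :
  0 <= r -> (0 <= x)%E -> (x <= y)%E -> (x `^ r <= y `^ r)%E.
Proof.
move=> r0 x0 xy; have y0 := le_trans x0 xy.
by apply: gt0_ler_poweR => //; rewrite in_itv/= leey andbT.
Qed.

Section hoelder_product.
Context d (T : measurableType d) (R : realType) (mu : {measure set T -> \bar R}).
Local Open Scope ereal_scope.

(** Hoelder's inequality in the form where the exponents sit on the integrands,
    which makes it symmetric and easy to iterate. *)
Lemma hoelder_powR (U V : T -> R) (a b : R) :
  measurable_fun [set: T] U -> measurable_fun [set: T] V ->
  (forall x, 0 <= U x)%R -> (forall x, 0 <= V x)%R ->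
  (0 < a)%R -> (0 < b)%R -> (a + b = 1)%R ->
  \int[mu]_x (U x `^ a * V x `^ b)%:E <=
  (\int[mu]_x (U x)%:E) `^ a * (\int[mu]_x (V x)%:E) `^ b.
Proof.
move=> mU mV U0 V0 a0 b0 ab.
have mpow (W : T -> R) c : measurable_fun [set: T] W ->
    measurable_fun [set: T] (fun x => W x `^ c)%R.
  by move=> mW; exact: (measurableT_comp (measurable_powR _)).
have normE (W : T -> R) c : (forall x, 0 <= W x)%R -> (0 < c)%R ->
    'N[mu]_(c^-1)%:E[EFin \o (fun x => W x `^ c)%R] = (\int[mu]_x (W x)%:E) `^ c.
  move=> W0 c0; rewrite unlock invrK; congr (_ `^ _).
  apply: eq_integral => x _ /=.
  by rewrite ger0_norm ?powR_ge0// -powRrM mulfV ?gt_eqF// powRr1.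
have := @hoelder _ _ _ mu _ _ a^-1 b^-1 (mpow U a mU) (mpow V b mV).
rewrite !invr_gt0 !invrK => /(_ a0 b0 ab); rewrite !normE// Lnorm1.
apply: le_trans; apply: ge0_le_integral => //=.
- by move=> x _; rewrite lee_fin mulr_ge0// powR_ge0.
- by apply/measurable_EFinP/measurable_funM; exact: mpow.
- by apply/measurable_EFinP/measurableT_comp => //; apply/measurable_funM; exact: mpow.
- by move=> x _; rewrite lee_fin ler_norm.
Qed.

(** The two-factor inequality is used twice: first U against the normalised
    product Z of the other two factors, then inside Z. *)
Lemma hoelder_powR3 (U V W : T -> R) (a b c : R) :
  measurable_fun [set: T] U -> measurable_fun [set: T] V ->
  measurable_fun [set: T] W ->
  (forall x, 0 <= U x)%R -> (forall x, 0 <= V x)%R -> (forall x, 0 <= W x)%R ->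
  (0 < a)%R -> (0 < b)%R -> (0 < c)%R -> (a + b + c = 1)%R ->
  \int[mu]_x (U x `^ a * (V x `^ b * W x `^ c))%:E <=
  (\int[mu]_x (U x)%:E) `^ a *
  ((\int[mu]_x (V x)%:E) `^ b * (\int[mu]_x (W x)%:E) `^ c).
Proof.
move=> mU mV mW U0 V0 W0 a0 b0 c0 abc.
have s0 : (0 < b + c)%R by rewrite addr_gt0.
have sN0 : (b + c != 0)%R by rewrite gt_eqF.
pose Z x := (V x `^ (b / (b + c)) * W x `^ (c / (b + c)))%R.
have mZ : measurable_fun [set: T] Z.
  by apply: measurable_funM; exact: (measurableT_comp (measurable_powR _)).
have Z0 x : (0 <= Z x)%R by rewrite mulr_ge0 ?powR_ge0.
have ZE x : (V x `^ b * W x `^ c = Z x `^ (b + c))%R.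
  by rewrite powRM ?powR_ge0// -!powRrM !divfK.
under eq_integral do rewrite ZE.
apply: le_trans (hoelder_powR mU mZ U0 Z0 a0 s0 _) _; first by rewrite addrA.
apply: lee_wpmul2l; first exact: poweR_ge0.
have int0 (W' : T -> R) : (forall x, 0 <= W' x)%R -> 0 <= \int[mu]_x (W' x)%:E.
  by move=> W'0; apply: integral_ge0 => x _; rewrite lee_fin.
have powE y z : y `^ b * z `^ c = (y `^ (b / (b + c)) * z `^ (c / (b + c))) `^ (b + c).
  by rewrite poweRM ?poweR_ge0// -!poweRrM !divfK.
rewrite powE.
apply: lee_poweR; [exact: ltW|exact: int0|].
by apply: hoelder_powR; rewrite ?divr_gt0// -mulrDl mulfV.
Qed.

End hoelder_product.

(** The exponents of k^q are 1/r and 1 - 1/p, whose sum is 1/q; those of f^p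
    are 1/r and 1 - 1/q, whose sum is 1/p. *)
Lemma young_splitting (R : realType) (p q r k f : R) :
  0 < p -> 0 < q -> p^-1 + q^-1 = 1 + r^-1 -> 0 <= k -> 0 <= f ->
  k * f = (k `^ q * f `^ p) `^ r^-1 *
          (f `^ p `^ (1 - q^-1) * k `^ q `^ (1 - p^-1)).
Proof.
move=> p0 q0 pqr k0 f0.
have powE (x a b c : R) : 0 < c -> a + b = c^-1 -> 0 <= x ->
    x `^ c `^ a * x `^ c `^ b = x.
  move=> c0 abc x0; rewrite -powRD abc; last by rewrite invr_eq0 (gt_eqF c0).
  by rewrite -powRrM mulfV ?(gt_eqF c0)// powRr1.
rewrite powRM; [|exact: powR_ge0|exact: powR_ge0].
rewrite [X in _ = _ * X]mulrC mulrACA.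
have pE : r^-1 + (1 - q^-1) = p^-1 by rewrite addrCA addrA -pqr addrK.
have qE : r^-1 + (1 - p^-1) = q^-1.
  by rewrite addrCA addrA -pqr addrAC addrN add0r.
by congr (_ * _); apply/esym; apply: powE.
Qed.

(** The powers that the factors of [young_splitting] contribute once Hoelder's
    inequality is raised to the power r. *)
Lemma young_exponents (R : realType) (p q r : R) :
  r != 0 -> p^-1 + q^-1 = 1 + r^-1 ->
  r / p - 1 = (1 - q^-1) * r /\ r / q - 1 = (1 - p^-1) * r.
Proof.
move=> r0 pqr.
have -> : 1 - q^-1 = p^-1 - r^-1 by lra.
have -> : 1 - p^-1 = q^-1 - r^-1 by lra.
by rewrite !mulrBl mulVf// ![r / _]mulrC.
Qed.

Section young.
Context d1 d2 (T1 : measurableType d1) (T2 : measurableType d2) (R : realType).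
Context (m1 : {sigma_finite_measure set T1 -> \bar R}).
Context (m2 : {sigma_finite_measure set T2 -> \bar R}).
Local Open Scope ereal_scope.

(** Hoelder's inequality for the splitting [young_splitting], raised to the
    power r, bounds the r-th power of the integral over y by D times the
    integral J(x) of K(x,.)^q F^p, where D depends on neither variable. Tonelli's
    theorem and the bound on the integrals of K(.,y)^q then give the claim. *)
Lemma young_kernel (K : T1 * T2 -> R) (F : T2 -> R) (p q r : R) (C : \bar R) :
  measurable_fun [set: T1 * T2] K -> measurable_fun [set: T2] F ->
  (forall z, 0 <= K z)%R -> (forall y, 0 <= F y)%R ->
  0 <= C -> (1 < p)%R -> (1 < q)%R -> (0 < r)%R -> (p^-1 + q^-1 = 1 + r^-1)%R ->
  (forall x, \int[m2]_y (K (x, y) `^ q)%:E <= C) ->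
  (forall y, \int[m1]_x (K (x, y) `^ q)%:E <= C) ->
  \int[m1]_x (\int[m2]_y (K (x, y) * F y)%:E) `^ r <=
  C `^ (r / q) * (\int[m2]_y (F y `^ p)%:E) `^ (r / p).
Proof.
move=> mK mF K0 F0 C0 p1 q1 r0 pqr KxC KyC.
have [p0 q0] : (0 < p)%R /\ (0 < q)%R by split; exact: lt_trans ltr01 _.
have [pN0 qN0 rN0] : [/\ p != 0, q != 0 & r != 0]%R by rewrite !gt_eqF.
pose Kq z := (K z `^ q)%R; pose Fp y := (F y `^ p)%R.
have mKq : measurable_fun [set: T1 * T2] Kq.
  exact: (measurableT_comp (measurable_powR _)).
have mFp : measurable_fun [set: T2] Fp.
  exact: (measurableT_comp (measurable_powR _)).
have Kq0 z : (0 <= Kq z)%R by exact: powR_ge0.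
have Fp0 y : (0 <= Fp y)%R by exact: powR_ge0.
set A := \int[m2]_y (F y `^ p)%:E.
have A0 : 0 <= A by apply: integral_ge0 => y _; rewrite lee_fin powR_ge0.
have b0 : (0 < 1 - q^-1)%R by rewrite subr_gt0 invf_lt1.
have [rpE rqE] : (r / p - 1 = (1 - q^-1) * r /\ r / q - 1 = (1 - p^-1) * r)%R.
  exact: young_exponents.
have c0 : (0 < 1 - p^-1)%R by rewrite subr_gt0 invf_lt1.
pose D := A `^ (r / p - 1) * C `^ (r / q - 1).
have D0 : 0 <= D by rewrite mule_ge0 ?poweR_ge0.
pose J x := \int[m2]_y (Kq (x, y) * Fp y)%:E.
have mKF : measurable_fun [set: T1 * T2] (fun z => (Kq z * Fp z.2)%:E).
  apply/measurable_EFinP/measurable_funM => //.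
  exact: (measurableT_comp mFp).
have J0 x : 0 <= J x.
  by apply: integral_ge0 => y _; rewrite lee_fin mulr_ge0.
have mJ : measurable_fun [set: T1] J.
  apply: (measurable_fun_fubini_tonelli_F (fun z => (Kq z * Fp z.2)%:E)) => //.
  by move=> z; rewrite lee_fin mulr_ge0.
have KFE z : (K z * F z.2 = (Kq z * Fp z.2) `^ r^-1 *
    (Fp z.2 `^ (1 - q^-1) * Kq z `^ (1 - p^-1)))%R by exact: young_splitting.
have step x : (\int[m2]_y (K (x, y) * F y)%:E) `^ r <= D * J x.
  have mKx : measurable_fun [set: T2] (fun y => Kq (x, y)).
    exact: measurable_fun_pair2.
  under eq_integral do rewrite (KFE (x, _)) /=.
  have int0 (W : T2 -> R) : (forall y, 0 <= W y)%R -> 0 <= \int[m2]_y (W y)%:E.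
    by move=> W0; apply: integral_ge0 => y _; rewrite lee_fin.
  have -> : D * J x = (J x `^ r^-1 * (A `^ (1 - q^-1) * C `^ (1 - p^-1))) `^ r.
    rewrite !poweRM ?mule_ge0 ?poweR_ge0// -!poweRrM mulVf// poweRe1// muleC.
    by rewrite -rpE -rqE.
  apply: lee_poweR; first exact: ltW.
    by apply: int0 => y; rewrite !mulr_ge0 ?powR_ge0.
  apply: le_trans (hoelder_powR3 _ _ mFp mKx _ _ _ _ b0 c0 _) _; rewrite ?invr_gt0//.
    exact: measurable_funM.
    by move=> y; rewrite mulr_ge0.
    by rewrite [(r^-1 + _)%R]addrCA [(1 + (r^-1 - _))%R]addrA -pqr addrK addrC subrK.
  do 2 (apply: lee_wpmul2l; [by rewrite poweR_ge0|]).
  by apply: lee_poweR; [exact: ltW|exact: int0|exact: KxC].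
have intJ : \int[m1]_x J x <= C * A.
  rewrite /J (fubini_tonelli (fun z => (Kq z * Fp z.2)%:E))//=; last first.
    by move=> z; rewrite lee_fin mulr_ge0.
  rewrite /A -ge0_integralZl//; last 2 first.
  - exact/measurable_EFinP.
  - by move=> y _; rewrite lee_fin powR_ge0.
  apply: ge0_le_integral => //.
  - by move=> y _; apply: integral_ge0 => x _; rewrite lee_fin mulr_ge0.
  - apply: (measurable_fun_fubini_tonelli_G (fun z => (Kq z * Fp z.2)%:E)) => //.
    by move=> z; rewrite lee_fin mulr_ge0.
  - by apply: emeasurable_funM => //; exact/measurable_EFinP.
  - move=> y _; under eq_integral do rewrite mulrC EFinM.
    rewrite ge0_integralZl//.
    + rewrite [X in X <= _]muleC -/(Fp y).
      by apply: lee_wpmul2r; [rewrite lee_fin|exact: KyC].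
    + by apply/measurable_EFinP; exact: measurable_fun_pair1.
    + by move=> x _; rewrite lee_fin.
    + by rewrite lee_fin.
apply: (@le_trans _ _ (D * (C * A))).
  apply: (@le_trans _ _ (D * \int[m1]_x J x)); last exact: lee_wpmul2l.
  rewrite -ge0_integralZl//; apply: ge0_le_integral => //.
  - by move=> x _; exact: poweR_ge0.
  - apply: (measurableT_comp (measurable_poweR _)).
    apply: (measurable_fun_fubini_tonelli_F (fun z => (K z * F z.2)%:E)).
      apply/measurable_EFinP/measurable_funM => //.
      exact: (measurableT_comp mF).
    by move=> z; rewrite lee_fin mulr_ge0.
  - exact: emeasurable_funM.
have powE y s : 0 <= y -> s != 0%R -> y `^ (s - 1) * y = y `^ s.
  move=> y0 s0; rewrite -[X in _ * X](poweRe1 y0) -poweRD ?subrK//.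
  by apply: add_neq0_poweRD_def; rewrite subrK.
rewrite /D [C * A]muleC muleACA !powE// ?mulf_neq0 ?invr_eq0//.
by rewrite muleC.
Qed.

End young.

(** * Borel sets of second countable spaces *)

(** The set [D] may be empty, in which case no sequence enumerates it: this is
    why the terms of [G] are allowed to be empty. *)
Lemma countable_bigcup_sequence (I T : Type) (D : set I) (F : I -> set T) :
  countable D -> exists2 G : nat -> set T, \bigcup_(i in D) F i = \bigcup_n G n
    & forall n, G n = set0 \/ exists2 i, D i & G n = F i.
Proof.
move=> /countable_injP[e einj].
exists (fun n => \bigcup_(i in [set i | D i /\ e i = n]) F i).
  apply/seteqP; split=> [t [i Di Fit]|t [n _ [i [Di _]] Fit]]; last by exists i.
  by exists (e i) => //; exists i.
move=> n; have [[i [Di ein]]|nD] := pselect (exists i, D i /\ e i = n).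
  right; exists i => //; apply/seteqP; split=> [t [j [Dj ejn]] Fjt|t Fit].
    by rewrite (einj i j) ?inE// ein ejn.
  by exists i.
by left; apply/seteqP; split => // t [i [Di ein] _]; apply: nD; exists i.
Qed.

Lemma open_borel (T : ptopologicalType) (U : set T) :
  open U -> measurable (U : set (borel T)).
Proof. exact: sub_sigma_algebra. Qed.

Lemma basis_nbhs (T : topologicalType) (B : set (set T)) (x : T) (A : set T) :
  basis B -> nbhs x A -> exists U, [/\ B U, U x & U `<=` A].
Proof. by move=> [_ /(_ x) /[apply]] [U [BU Ux] UA]; exists U. Qed.

(** Second countability matters here: the Borel sigma-algebra of a
    product can be larger than the product of the Borel sigma-algebras. *)
Lemma continuous_measurable_prod (T1 T2 T3 : ptopologicalType)
    (h : T1 * T2 -> T3) :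
  @second_countable T1 -> @second_countable T2 -> continuous h ->
  measurable_fun [set: borel T1 * borel T2] (h : borel T1 * borel T2 -> borel T3).
Proof.
move=> [B1 cB1 bB1] [B2 cB2 bB2] ch.
refine (@measurability _ _ (borel T1 * borel T2)%type (borel T3) _ h (@open T3)
  _ _); [done|] => _ [U oU <-]; rewrite setTI.
pose D := [set V : set T1 * set T2 |
  [/\ B1 V.1, B2 V.2 & V.1 `*` V.2 `<=` h @^-1` U]].
have cD : countable D.
  apply: (@sub_countable _ _ _ (B1 `*` B2)); last exact: countableX.
  by apply: subset_card_le => V [].
have [G GE Gn] := countable_bigcup_sequence (fun V => V.1 `*` V.2) cD.
have -> : h @^-1` U = \bigcup_n G n.
  rewrite -GE; apply/seteqP; split=> [[x y] hU|z [V [_ _ VU]] Vz]; last exact: VU.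
  have /ch[/= [V1 V2] [/= nV1 nV2] V12] : nbhs (h (x, y)) U by exact: open_nbhs_nbhs.
  have [W1 [BW1 W1x W1V]] := basis_nbhs bB1 nV1.
  have [W2 [BW2 W2y W2V]] := basis_nbhs bB2 nV2.
  exists (W1, W2); split => //= -[a b] [/= W1a W2b].
  by apply: V12; split; [exact: W1V|exact: W2V].
apply: bigcupT_measurable => n.
have [->|[[V1 V2] [/= BV1 BV2 _] ->]] := Gn n; first exact: measurable0.
by apply: measurableX; apply: open_borel; [exact: bB1.1|exact: bB2.1].
Qed.

Lemma continuous_borel (T1 T2 : ptopologicalType) (h : T1 -> T2) :
  continuous h -> measurable_fun [set: borel T1] (h : borel T1 -> borel T2).
Proof.
move=> /continuousP ch; apply: (@measurability _ _ (borel T1) (borel T2) _ h (@open T2)) => // _ [U oU <-].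
by rewrite setTI; apply: open_borel; exact: ch.
Qed.

(** Lindeloef's argument: the basic open sets of finite measure form a countable
    cover. *)
Lemma locally_finite_sigma_finite (R : realType) (T : ptopologicalType)
    (mu : {measure set (borel T) -> \bar R}) :
  @second_countable T ->
  (forall x : T, exists U : set T, [/\ open U, U x & (mu U < +oo)%E]) ->
  sigma_finite [set: borel T] mu.
Proof.
move=> [B cB bB] lf.
have cD : countable [set U | B U /\ (mu U < +oo)%E].
  apply: (@sub_countable _ _ _ B) => //; by apply: subset_card_le => U [].
have [G GE Gn] := countable_bigcup_sequence id cD.
exists G; last first.
  move=> n; have [->|[U [BU Uoo] ->]] := Gn n; first by rewrite measure0.
  by split => //; apply: open_borel; exact: bB.1.
rewrite -GE; apply/seteqP; split => // x _.
have [U [oU Ux Uoo]] := lf x.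
have [W [BW Wx WU]] := basis_nbhs bB (open_nbhs_nbhs (conj oU Ux)).
exists W => //; split => //; apply: le_lt_trans Uoo.
by apply: le_measure => //; rewrite inE; apply: open_borel => //; exact: bB.1.
Qed.

(** Tonelli's theorem is stated for the structure of sigma-finite measures; this
    equips a given measure with it without changing the measure. *)
Lemma sigma_finite_structure d (T : measurableType d) (R : realType)
    (mu : {measure set T -> \bar R}) : sigma_finite [set: T] mu ->
  exists nu : {sigma_finite_measure set T -> \bar R},
    nu = mu :> {measure set T -> \bar R}.
Proof.
move=> sf.
pose sfin := isSFinite.Build _ _ _ mu (sfinite_measure_sigma_finite sf).
pose sigfin := isSigmaFinite.Build _ _ _ mu sf.
exists (HB.pack_for {sigma_finite_measure set T -> \bar R}
  (Measure.sort mu) sfin sigfin).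
exact: eq_measure.
Qed.

(** A point is compact, hence of finite measure, and outer regularity
    approximates its measure by that of open neighborhoods. *)
Lemma radon_locally_finite (R : realType) (n : nat) (X : lieGroupType R n)
    (mu : {measure set (borel X) -> \bar R}) (x : X) :
  radon mu -> exists U : set X, [/\ open U, U x & (mu U < +oo)%E].
Proof.
move=> [muK outer _].
have mx : measurable ([set x] : set (borel X)).
  rewrite -[X in measurable X]setCK; apply: measurableC; apply: open_borel.
  rewrite openC; apply: accessible_closed_set1; apply: hausdorff_accessible.
  exact: lie_hausdorff.
have : (mu [set x] < +oo)%E by apply: muK; exact: compact_set1.
rewrite outer// => /ereal_inf_lt[_ [U [oU xU] <-] Uoo].
by exists U; split => //; exact: xU.
Qed.

Lemma ge0_integral_preserving d (T : measurableType d) (R : realType)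
    (mu : {measure set T -> \bar R}) (phi : T -> T) (h : T -> \bar R) :
  measurable_fun [set: T] phi ->
  (forall A, measurable A -> mu (phi @^-1` A) = mu A) ->
  measurable_fun [set: T] h -> (forall x, 0 <= h x)%E ->
  (\int[mu]_x h (phi x) = \int[mu]_x h x)%E.
Proof.
move=> mphi phimu mh h0.
transitivity (\int[pushforward mu phi]_x h x)%E.
  by rewrite ge0_integral_pushforward// preimage_setT.
by apply: eq_measure_integral => A mA _; exact: phimu.
Qed.

(** * Invariant integrals on a Lie group *)

Section haar_integral.
Context (R : realType) (n : nat) (X : lieGroupType R n).
Variable mu : {measure set (borel X) -> \bar R}.
Implicit Types (x y : X) (h k : borel X -> \bar R).

Lemma measurable_mulg : measurable_fun [set: borel X * borel X]
  ((fun z => (z.1 * z.2)%g) : borel X * borel X -> borel X).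
Proof.
by apply: continuous_measurable_prod;
  [exact: lie_second_countable..|exact: lie_mul_cts].
Qed.

Lemma measurable_invg : measurable_fun [set: borel X]
  ((fun x => x^-1%g) : borel X -> borel X).
Proof. by apply: continuous_borel; exact: lie_inv_cts. Qed.

Lemma measurable_mulg_comp d (T : measurableType d) (u v : T -> borel X) :
  measurable_fun [set: T] u -> measurable_fun [set: T] v ->
  measurable_fun [set: T] ((fun t => (u t * v t)%g) : T -> borel X).
Proof.
move=> mu' mv; exact: (measurableT_comp measurable_mulg (measurable_fun_pair mu' mv)).
Qed.

Lemma measurable_invg_comp d (T : measurableType d) (u : T -> borel X) :
  measurable_fun [set: T] u ->
  measurable_fun [set: T] ((fun t => (u t)^-1%g) : T -> borel X).
Proof. by move=> mu'; exact: (measurableT_comp measurable_invg). Qed.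

Lemma integral_left_translate h x : left_invariant mu ->
  measurable_fun [set: borel X] h -> (forall y, 0 <= h y)%E ->
  (\int[mu]_y h (x * y)%g = \int[mu]_y h y)%E.
Proof.
move=> linv mh h0.
apply: (@ge0_integral_preserving _ _ _ mu (fun y : borel X => (x * y)%g : borel X)) => //.
  by apply: measurable_mulg_comp.
move=> A mA; rewrite -(linv x^-1%g A mA); congr (mu _).
apply/seteqP; split=> [y /= Axy|_ [y Ay <-]/=]; last by rewrite mulVKg.
by exists (x * y)%g => //; rewrite mulKg.
Qed.

Lemma integral_right_translate h x : right_invariant mu ->
  measurable_fun [set: borel X] h -> (forall y, 0 <= h y)%E ->
  (\int[mu]_y h (y * x)%g = \int[mu]_y h y)%E.
Proof.
move=> rinv mh h0.
apply: (@ge0_integral_preserving _ _ _ mu (fun y : borel X => (y * x)%g : borel X)) => //.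
  by apply: measurable_mulg_comp.
move=> A mA; rewrite -(rinv x^-1%g A mA); congr (mu _).
apply/seteqP; split=> [y /= Axy|_ [y Ay <-]/=]; last by rewrite mulgVK.
by exists (y * x)%g => //; rewrite mulgK.
Qed.

End haar_integral.

Section unimodular_inversion.
Context (R : realType) (n : nat) (X : lieGroupType R n).
Variable mu : {sigma_finite_measure set (borel X) -> \bar R}.
Local Open Scope ereal_scope.

(** Take the indicator h of a set A of finite positive measure and integrate
    h(x) k(y^-1 x) over x and y. Integrating in y first, the substitution of
    x y for y gives mu(A) times the integral of k(y^-1). Integrating in x first,
    the substitution of y x for x turns the integrand into h(y x) k(x), whose
    integral over y and then x is mu(A) times the integral of k, by right
    invariance. *)
Lemma unimodular_integral_inv (k : borel X -> \bar R) :
  unimodular mu -> mu [set: borel X] != 0 ->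
  measurable_fun [set: borel X] k -> (forall y, 0 <= k y) ->
  \int[mu]_y k (y^-1)%g = \int[mu]_y k y.
Proof.
move=> [linv rinv] muN0 mk k0.
have [A [mA A0 Aoo]] : exists A : set (borel X),
    [/\ measurable A, 0 < mu A & mu A < +oo].
  have [F FT mF] := sigma_finiteT mu.
  have [[i Fi]|F0] := pselect (exists i, mu (F i) != 0).
    by exists (F i); have [? ?] := mF i; split; rewrite // lt0e Fi measure_ge0.
  case/eqP: muN0; apply/eqP; rewrite -measure_le0 FT.
  apply: le_trans (generalized_Boole_inequality _ _ _) _.
  - by move=> i; have [] := mF i.
  - by apply: bigcupT_measurable => i; have [] := mF i.
  rewrite eseries0// => i _ _; apply/eqP; apply: contrapT => Fi.
  by apply: F0; exists i; exact/negP.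
pose h (x : borel X) : \bar R := (\1_A x)%:E.
have mh : measurable_fun [set: borel X] h.
  by apply/measurable_EFinP; exact: measurable_indic.
have h0 x : 0 <= h x by rewrite lee_fin.
have inth : \int[mu]_x h x = mu A by rewrite integral_indic// setIT.
pose W (z : borel X * borel X) := h z.1 * k (z.2^-1 * z.1)%g.
have W0 z : 0 <= W z by rewrite mule_ge0.
have mW : measurable_fun setT W.
  apply: emeasurable_funM; first exact: (measurableT_comp mh).
  apply: (measurableT_comp mk); apply: measurable_mulg_comp => //.
  exact: measurable_invg_comp.
have mkV : measurable_fun [set: borel X] (fun y : borel X => k (y^-1)%g).
  by apply: (measurableT_comp mk); exact: measurable_invg.
have lhs x : \int[mu]_y W (x, y) = h x * \int[mu]_y k (y^-1)%g.
  rewrite /W/= ge0_integralZl//; last first.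
    apply: (measurableT_comp mk); apply: measurable_mulg_comp => //.
    exact: measurable_invg.
  congr (_ * _).
  rewrite -(integral_left_translate x^-1%g linv mkV)//.
  by apply: eq_integral => y _; rewrite invgM invgK.
have rhs y : \int[mu]_x W (x, y) = \int[mu]_x (h (y * x)%g * k x).
  rewrite -(@integral_left_translate _ _ _ mu (fun x => W (x, y)) y linv)//.
    by apply: eq_integral => x _; rewrite /W/= mulKg.
  exact: measurable_fun_pair1.
have mhk : measurable_fun setT
    (fun z : borel X * borel X => h (z.1 * z.2)%g * k z.2).
  apply: emeasurable_funM; last exact: (measurableT_comp mk).
  by apply: (measurableT_comp mh); exact: measurable_mulg.
have hk0 (z : borel X * borel X) : 0 <= h (z.1 * z.2)%g * k z.2 by rewrite mule_ge0.
have /esym := fubini_tonelli W mW W0 : \int[mu]_x _ = \int[mu]_y _.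
under eq_integral do rewrite rhs.
rewrite (fubini_tonelli (fun z : borel X * borel X => h (z.1 * z.2)%g * k z.2) mhk hk0)/=.
under eq_integral => x _.
  rewrite ge0_integralZr//; last first.
    by apply: (measurableT_comp mh); apply: measurable_mulg_comp.
  rewrite integral_right_translate// inth.
  over.
under [X in _ = X -> _]eq_integral do rewrite lhs.
rewrite ge0_integralZl// ge0_integralZr//; last first.
  by apply: integral_ge0.
have muAfin : mu A \is a fin_num by rewrite ge0_fin_numE.
rewrite inth => /eqP; rewrite eq_le !lee_pmul2l// => le_k.
exact/esym/le_anti.
Qed.

End unimodular_inversion.

Lemma measurable_fun_integral_prod d1 d2 (T1 : measurableType d1)
    (T2 : measurableType d2) (R : realType)
    (m2 : {sigma_finite_measure set T2 -> \bar R}) (h : T1 * T2 -> \bar R) :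
  measurable_fun [set: T1 * T2] h ->
  measurable_fun [set: T1] (fun x => \int[m2]_y h (x, y))%E.
Proof.
move=> mh; under eq_fun do rewrite integralE.
apply: emeasurable_funB.
  have := @measurable_fun_fubini_tonelli_F _ _ _ _ _ m2 (h^\+)%E
    (measurable_funepos mh) (funepos_ge0 h).
  congr measurable_fun; apply/funext => x.
  by apply: eq_integral => y _; rewrite !funeposE.
have := @measurable_fun_fubini_tonelli_F _ _ _ _ _ m2 (h^\-)%E
  (measurable_funeneg mh) (funeneg_ge0 h).
congr measurable_fun; apply/funext => x.
by apply: eq_integral => y _; rewrite !funenegE.
Qed.

(** Where the extended integral of [h] is infinite, the real-valued one is 0, so
    the inequality covers that case too. *)
Lemma le_abs_Rintegral d (T : measurableType d) (R : realType)
    (mu : {measure set T -> \bar R}) (h : T -> R) :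
  measurable_fun [set: T] h ->
  ((`|\int[mu]_x h x|)%:E <= \int[mu]_x (`|h x|)%:E)%E.
Proof.
move=> mh; apply: (@le_trans _ _ `|\int[mu]_x (h x)%:E|%E).
  by rewrite /Rintegral; case: (\int[mu]_x _)%E => [t| |]//=; rewrite normr0 leey.
by apply: le_abse_integral => //; exact/measurable_EFinP.
Qed.

(** * Young's inequality for the convolution *)

Section young_convolution.
Context (R : realType) (n : nat) (X : lieGroupType R n).
Variable mu : {sigma_finite_measure set (borel X) -> \bar R}.
Variables f g : X -> R.
Hypothesis mf : measurable_fun [set: borel X] f.
Hypothesis mg : measurable_fun [set: borel X] g.
Hypothesis mu_unimodular : unimodular mu.
Hypothesis mu_neq0 : mu [set: borel X] != 0%E.

Lemma measurable_convolution_kernel : measurable_fun [set: borel X * borel X]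
  ((fun z => g (z.1 * z.2^-1)%g * f z.2) : borel X * borel X -> R).
Proof.
apply: measurable_funM; last exact: (measurableT_comp mf).
apply: (measurableT_comp mg); apply: measurable_mulg_comp => //.
exact: measurable_invg_comp.
Qed.

Lemma measurable_convolution :
  measurable_fun [set: borel X] (convolution mu f g).
Proof.
apply: (measurableT_comp (fine_measurable _)) => //.
apply: (@measurable_fun_integral_prod _ _ _ _ _ mu
  (fun z : borel X * borel X => (g (z.1 * z.2^-1)%g * f z.2)%:E)).
by apply/measurable_EFinP; exact: measurable_convolution_kernel.
Qed.

(** The convolution of |f| and |g|, which is allowed to be infinite. *)
Let J (x : borel X) : \bar R :=
  (\int[mu]_y (`|g (x * y^-1)%g * f y|)%:E)%E.

Let mJ : measurable_fun [set: borel X] J.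
Proof.
apply: (@measurable_fun_integral_prod _ _ _ _ _ mu
  (fun z : borel X * borel X => (`|g (z.1 * z.2^-1)%g * f z.2|)%:E)).
apply/measurable_EFinP/measurableT_comp => //.
exact: measurable_convolution_kernel.
Qed.

Let J_ge0 x : (0 <= J x)%E.
Proof. by apply: integral_ge0 => y _; rewrite lee_fin. Qed.

Variables p q r : R.
Hypotheses (p_gt1 : 1 < p) (q_gt1 : 1 < q) (r_gt0 : 0 < r).
Hypothesis pqr : p^-1 + q^-1 = 1 + r^-1.

Notation "''N_' s [ h ]" := (Lnorm mu s%:E (EFin \o (h : borel X -> R))).

Let integral_J : (\int[mu]_x J x `^ r <= ('N_p[f] * 'N_q[g]) `^ r)%E.
Proof.
pose gq (y : borel X) := (`|g y| `^ q)%:E.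
have mgq : measurable_fun [set: borel X] gq.
  apply/measurable_EFinP/(measurableT_comp (measurable_powR _)).
  exact: measurableT_comp.
have gq0 y : (0 <= gq y)%E by rewrite lee_fin powR_ge0.
have [linv rinv] := mu_unimodular.
rewrite poweRM ?Lnorm_ge0// [leRHS]muleC !unlock -!poweRrM.
rewrite [q^-1 * r]mulrC [p^-1 * r]mulrC.
rewrite (_ : \int[mu]_x J x `^ r = \int[mu]_x
    (\int[mu]_y (`|g (x * y^-1)%g| * `|f y|)%:E) `^ r)%E; last first.
  apply: eq_integral => x _; congr (_ `^ _)%E; apply: eq_integral => y _.
  by rewrite normrM.
pose K (z : borel X * borel X) := `|g (z.1 * z.2^-1)%g|.
have mK : measurable_fun [set: borel X * borel X] K.
  apply: measurableT_comp => //; apply: (measurableT_comp mg).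
  by apply: measurable_mulg_comp => //; exact: measurable_invg_comp.
have mF : measurable_fun [set: borel X] (fun y : borel X => `|f y|).
  exact: measurableT_comp.
have C0 : (0 <= \int[mu]_y gq y)%E by apply: integral_ge0 => y _; exact: gq0.
apply: (young_kernel mK mF _ _ C0 p_gt1 q_gt1 r_gt0 pqr).
- by move=> z; exact: normr_ge0.
- by move=> y; exact: normr_ge0.
(* The integrand is gq (x y^-1): inversion reduces it to a left translate. *)
- move=> x; rewrite -(integral_left_translate x linv mgq gq0).
  have mgx : measurable_fun [set: borel X] (fun y : borel X => gq (x * y)%g).
    by apply: (measurableT_comp mgq); exact: measurable_mulg_comp.
  rewrite -(unimodular_integral_inv mu_unimodular mu_neq0 mgx); first exact: lexx.
  by move=> y; exact: gq0.
- move=> y; rewrite -(integral_right_translate (y^-1)%g rinv mgq gq0).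
  exact: lexx.
Qed.

Lemma young_convolution : ('N_r[convolution mu f g] <= 'N_p[f] * 'N_q[g])%E.
Proof.
have N0 : (0 <= 'N_p[f] * 'N_q[g])%E by rewrite mule_ge0 ?Lnorm_ge0.
have rN0 : r != 0 by rewrite gt_eqF.
rewrite -(poweRe1 N0) -(mulfV rN0) poweRrM {1}unlock.
apply: lee_poweR; first by rewrite invr_ge0 ltW.
  by apply: integral_ge0 => x _; exact: poweR_ge0.
apply: le_trans integral_J; apply: ge0_le_integral => //.
- by move=> x _; exact: poweR_ge0.
- apply: (measurableT_comp (measurable_poweR _)).
  apply: measurableT_comp => //; apply/measurable_EFinP.
  exact: measurable_convolution.
- exact: (measurableT_comp (measurable_poweR _)).
- move=> x _; apply: lee_poweR; [exact: ltW|exact: abse_ge0|].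
  apply: le_abs_Rintegral.
  exact: (measurable_fun_pair2 _ measurable_convolution_kernel).
Qed.

(** The r-th power of J is integrable, so J is finite almost everywhere. *)
Lemma ae_integrable_convolution : ('N_p[f] < +oo)%E -> ('N_q[g] < +oo)%E ->
  {ae mu, forall x : borel X, mu.-integrable [set: borel X]
            (fun y => (g (x * y^-1)%g * f y)%:E)}.
Proof.
move=> fp gq.
have iJ : mu.-integrable [set: borel X] (fun x => J x `^ r)%E.
  apply/integrableP; split; first exact: (measurableT_comp (measurable_poweR _)).
  under eq_integral do rewrite gee0_abs ?poweR_ge0//.
  apply: le_lt_trans integral_J _; apply: poweR_lty.
  by rewrite lte_mul_pinfty ?Lnorm_ge0// ge0_fin_numE ?Lnorm_ge0.
have := integrable_ae measurableT iJ.
apply: filterS => x /(_ Logic.I) Jfin.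
apply/integrableP; split.
  apply/measurable_EFinP.
  exact: (measurable_fun_pair2 _ measurable_convolution_kernel).
apply: (@lty_poweRy _ _ r); first by rewrite gt_eqF.
by rewrite -ge0_fin_numE// poweR_ge0.
Qed.

End young_convolution.

(** * Admissible weights and exponents *)

Lemma cvg_gt0_near (R : realType) (psi : R -> R) (F : set_system R) (l : \bar R) :
  (psi p)%:E @[p --> F] --> l -> (0 < l)%E ->
  exists2 c, 0 < c & \forall p \near F, c < psi p.
Proof.
move=> psil l0.
have [c c0 cl] : exists2 c, 0 < c & (c%:E < l)%E.
  case: l l0 {psil} => [t| |]//; last by exists 1; rewrite ?ltry.
  rewrite lte_fin => t0; exists (t / 2); first by rewrite divr_gt0.
  by rewrite lte_fin ltr_pdivrMr// ltr_pMr// ltr1n.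
have {}cl : nbhs l (fun u => (c%:E < u)%E) by exact: open_ereal_gt'.
by have := psil _ cl; exists c.
Qed.

(** Near each endpoint the weight stays above a positive constant because its
    limit there is positive or infinite; in between, it attains a positive
    minimum on a compact interval. *)
Lemma admissible_weight_bounded_below (R : realType) (a b : R) (psi : R -> R) :
  admissible_weight a b%:E psi ->
  exists2 c, 0 < c & forall p, oo_itv a b%:E p -> c <= psi p.
Proof.
move=> [cpsi psi0 _ [la [lb [cva cvb _]]]]; rewrite lt_min => /andP[la0 lb0].
have [ca ca0 nearca] := cvg_gt0_near cva la0.
have [cb cb0 nearcb] := cvg_gt0_near cvb lb0.
have [da /= da0 Ha] := nearca.
have [db /= db0 Hb] := nearcb.
have nearA p : a < p -> p < a + da -> ca <= psi p.
  move=> ap pa; apply/ltW/Ha => //=.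
  by rewrite ltr_norml; lra.
have nearB p : p < b -> b - db < p -> cb <= psi p.
  move=> pb bp; apply/ltW/Hb => //=.
  by rewrite ltr_norml; lra.
(* Halving da and db makes the compact interval overlap both neighborhoods. *)
have [le_ab|lt_ba] := leP (a + da / 2) (b - db / 2); last first.
  exists (Num.min ca cb); first by rewrite lt_min ca0.
  move=> p [ap]; rewrite lte_fin => pb; rewrite ge_min.
  have [pa|pa] := ltP p (a + da); first by rewrite nearA.
  by rewrite orbC nearB//; lra.
have [m mab mmin] : exists2 m, m \in `[a + da / 2, b - db / 2]%R &
    forall t, t \in `[a + da / 2, b - db / 2]%R -> psi m <= psi t.
  apply: EVT_min => //; apply: continuous_in_subspaceT => t.
  rewrite inE/= in_itv/= => /andP[at' tb]; apply: cpsi.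
  by split; [|rewrite lte_fin]; lra.
have [am mb] : a < m /\ m < b by move: mab; rewrite in_itv/= => /andP[? ?]; lra.
exists (Num.min (psi m) (Num.min ca cb)).
  by rewrite !lt_min ca0 cb0 psi0.
move=> p [ap]; rewrite lte_fin => pb; rewrite !ge_min.
have [pa|pa] := ltP p (a + da); first by rewrite nearA ?orbT.
have [bp|bp] := ltP (b - db) p; first by rewrite nearB ?orbT.
by rewrite mmin// in_itv/=; lra.
Qed.

Section exponents.
Variables (R : realType) (a1 a2 b1 b2 : R).
Hypotheses (a1_ge1 : 1 <= a1) (a2_ge1 : 1 <= a2) (a1b1 : a1 < b1) (a2b2 : a2 < b2).
Hypotheses (a12 : 1 < a1^-1 + a2^-1) (b12 : 1 < b1^-1 + b2^-1).

Lemma inv_exponent_formula (x y : R) : 0 < x -> 0 < y -> 1 < x^-1 + y^-1 ->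
  0 < x + y - x * y /\ (x * y / (x + y - x * y))^-1 = x^-1 + y^-1 - 1.
Proof.
move=> x0 y0 xy.
have xyE : x + y - x * y = (x^-1 + y^-1 - 1) * (x * y).
  by field; rewrite !gt_eqF.
have d0 : 0 < x + y - x * y by rewrite xyE !mulr_gt0// subr_gt0.
split=> //; rewrite invf_div xyE mulfK// mulf_neq0// gt_eqF//.
Qed.

Lemma inv_interpolation (a b t : R) : 0 < a -> a < b -> 0 < t -> t < 1 ->
  oo_itv a b%:E (a^-1 + t * (b^-1 - a^-1))^-1.
Proof.
move=> a0 ab t0 t1; have b0 := lt_trans a0 ab.
have ba : b^-1 < a^-1 by rewrite ltf_pV2.
have bV0 : 0 < b^-1 by rewrite invr_gt0.
set c := a^-1 + _.
have [bc ca] : b^-1 < c /\ c < a^-1.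
  rewrite /c; move: (a^-1) (b^-1) ba => u v vu; split; nra.
have c0 := lt_trans bV0 bc.
by split; rewrite ?lte_fin; [rewrite -[a]invrK|rewrite -[b]invrK];
  rewrite ltf_pV2 ?posrE ?invr_gt0.
Qed.

(** In terms of inverses, r^-1 lies strictly between 1/b1 + 1/b2 - 1 and
    1/a1 + 1/a2 - 1. Writing it as an interpolation of these bounds with
    parameter t, the same t interpolates 1/p between 1/a1 and 1/b1 and 1/q
    between 1/a2 and 1/b2. *)
Lemma exists_young_exponents (r : R) : exponent_A3 a1 a2 < r ->
  (r%:E < exponent_B3 b1%:E b2%:E)%E ->
  0 < r /\ exists p q, [/\ oo_itv a1 b1%:E p, oo_itv a2 b2%:E q &
    p^-1 + q^-1 = 1 + r^-1].
Proof.
have [a1_gt0 a2_gt0] : 0 < a1 /\ 0 < a2 by split; exact: lt_le_trans ltr01 _.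
have [b1_gt0 b2_gt0] : 0 < b1 /\ 0 < b2.
  by split; [exact: lt_trans _ a1b1|exact: lt_trans _ a2b2].
have [dA0 AE] := inv_exponent_formula a1_gt0 a2_gt0 a12.
have [dB0 BE] := inv_exponent_formula b1_gt0 b2_gt0 b12.
rewrite /exponent_A3 /exponent_B3 => Ar.
have -> : (b1%:E + b2%:E - b1%:E * b2%:E = (b1 + b2 - b1 * b2)%:E)%E by [].
rewrite inver gt_eqF// -!EFinM lte_fin => rB.
have A0 : 0 < a1 * a2 / (a1 + a2 - a1 * a2) by rewrite divr_gt0// mulr_gt0.
have r0 := lt_trans A0 Ar; split => //.
have B0 := lt_trans r0 rB.
have rA : r^-1 < a1^-1 + a2^-1 - 1 by rewrite -AE ltf_pV2.
have Br : b1^-1 + b2^-1 - 1 < r^-1 by rewrite -BE ltf_pV2.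
pose A := a1^-1 + a2^-1 - 1; pose B := b1^-1 + b2^-1 - 1.
have AB0 : 0 < A - B by rewrite subr_gt0 (lt_trans Br).
pose t := (A - r^-1) / (A - B).
have t0 : 0 < t by rewrite divr_gt0// subr_gt0.
have t1 : t < 1 by rewrite ltr_pdivrMr// mul1r ltrD2l ltrN2.
exists (a1^-1 + t * (b1^-1 - a1^-1))^-1, (a2^-1 + t * (b2^-1 - a2^-1))^-1.
split; [exact: inv_interpolation..|].
rewrite !invrK.
have -> : a1^-1 + t * (b1^-1 - a1^-1) + (a2^-1 + t * (b2^-1 - a2^-1)) =
  A + 1 - t * (A - B) by rewrite /A /B; ring.
by rewrite divfK ?gt_eqF//; ring.
Qed.

End exponents.

(** If one of the bounds is infinite, its inverse is 0, so the other inverse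
    would have to exceed 1. *)
Lemma finite_upper_exponents (R : realType) (a1 a2 : R) (b1 b2 : \bar R) :
  1 <= a1 -> 1 <= a2 -> (a1%:E < b1)%E -> (a2%:E < b2)%E ->
  (1 < b1^-1 + b2^-1)%E -> b1 \is a fin_num /\ b2 \is a fin_num.
Proof.
have oo_contra (a : R) (b : \bar R) : 1 <= a -> (a%:E < b)%E ->
    (1 < b^-1)%E -> False.
  move=> a_ge1; case: b => [b| |]//; last by rewrite invey => _; rewrite ltNge lee01.
  rewrite lte_fin => ab; have b_gt0 : 0 < b by lra.
  rewrite inver gt_eqF// lte_fin invf_gt1// ltNge => /negP[].
  exact: le_trans a_ge1 (ltW ab).
move=> a11 a21; case: b1 => [b1| |]//; case: b2 => [b2| |]//.
- by move=> ab _; rewrite invey adde0 => /(oo_contra _ _ a11 ab).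
- by move=> _ ab; rewrite invey add0e => /(oo_contra _ _ a21 ab).
- by move=> _ _; rewrite invey add0e ltNge lee01.
Qed.

(** * The convolution in the spaces G *)

Section G_norm.
Context (R : realType) (n : nat) (X : lieGroupType R n).
Variables (mu : {measure set (borel X) -> \bar R}) (psi : R -> R) (a b : R).
Variable h : X -> R.
Hypothesis psi_gt0 : forall p, oo_itv a b%:E p -> 0 < psi p.

Lemma Lnorm_le_G_norm (p : R) : oo_itv a b%:E p ->
  (Lnorm mu p%:E (EFin \o (h : borel X -> R)) <=
   G_norm mu psi a b%:E h * (psi p)%:E)%E.
Proof.
move=> abp; rewrite -lee_pdivrMr ?psi_gt0//; apply: ereal_sup_ubound.
by exists p => //; rewrite inver gt_eqF ?psi_gt0.
Qed.

Lemma G_norm_ge0 : a < b -> (0 <= G_norm mu psi a b%:E h)%E.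
Proof.
move=> ab; have abm : oo_itv a b%:E ((a + b) / 2).
  by split; rewrite ?lte_fin; lra.
apply: (@le_trans _ _ (Lnorm mu ((a + b) / 2)%:E (EFin \o (h : borel X -> R)) /
   (psi ((a + b) / 2))%:E)%E).
  by rewrite mule_ge0 ?Lnorm_ge0// inve_ge0 lee_fin ltW// psi_gt0.
by apply: ereal_sup_ubound; exists ((a + b) / 2).
Qed.

End G_norm.

Theorem theorem6 (R : realType) (n : nat) (X : lieGroupType R n)
    (mu : {measure set (borel X) -> \bar R})
    (a1 a2 : R) (b1 b2 : \bar R) (psi1 psi2 : R -> R) (f g : X -> R) :
  haar mu -> unimodular mu ->
  1 <= a1 -> (a1%:E < b1)%E -> 1 <= a2 -> (a2%:E < b2)%E ->
  1 < a1^-1 + a2^-1 -> (1 < b1^-1 + b2^-1)%E ->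
  admissible_weight a1 b1 psi1 -> admissible_weight a2 b2 psi2 ->
  f \in G_space mu psi1 a1 b1 -> g \in G_space mu psi2 a2 b2 ->
  [/\ {ae mu, forall x : borel X, mu.-integrable [set: borel X]
                (fun y => (g (x * y^-1)%g * f y)%:E)},
      measurable_fun [set: borel X] (convolution mu f g)
    & (G_norm mu (tau_weight a1 a2 b1 b2 psi1 psi2) (exponent_A3 a1 a2) (exponent_B3 b1 b2)
         (convolution mu f g)
       <= G_norm mu psi1 a1 b1 f * G_norm mu psi2 a2 b2 g)%E].
Proof.
move=> [linv mu_radon mu_neq0] mu_uni a1_ge1 ab1 a2_ge1 ab2 a12 b12.
have [] := finite_upper_exponents a1_ge1 a2_ge1 ab1 ab2 b12.
case: b1 ab1 b12 => // b1; case: b2 ab2 => // b2.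
rewrite !lte_fin => ab2 ab1 b12 _ _ adm1 adm2.
rewrite !inE => -[mf Gf] [mg Gg].
have [b1_gt0 b2_gt0] : 0 < b1 /\ 0 < b2 by split; lra.
move: b12; rewrite !inver !gt_eqF// -EFinD lte_fin => b12.
have [nu nu_mu] : exists nu : {sigma_finite_measure set (borel X) -> \bar R},
    nu = mu :> {measure set (borel X) -> \bar R}.
  apply: sigma_finite_structure; apply: locally_finite_sigma_finite.
    exact: lie_second_countable.
  by move=> x; exact: radon_locally_finite.
subst mu.
have [[c1 c1_gt0 c1P] [c2 c2_gt0 c2P]] :=
  (admissible_weight_bounded_below adm1, admissible_weight_bounded_below adm2).
have [[_ psi1_gt0 _ _] [_ psi2_gt0 _ _]] := (adm1, adm2).
have [Gf0 Gg0] := (G_norm_ge0 nu f psi1_gt0 ab1, G_norm_ge0 nu g psi2_gt0 ab2).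
have gt1 (a p : R) (b : \bar R) : 1 <= a -> oo_itv a b p -> 1 < p.
  by move=> a_ge1 [ap _]; exact: le_lt_trans a_ge1 ap.
have Lf_lty p : oo_itv a1 b1%:E p ->
    (Lnorm nu p%:E (EFin \o (f : borel X -> R)) < +oo)%E.
  move=> ?; apply: le_lt_trans (Lnorm_le_G_norm _ _ psi1_gt0 _) _ => //.
  by rewrite lte_mul_pinfty// ?ltry// ge0_fin_numE.
have Lg_lty q : oo_itv a2 b2%:E q ->
    (Lnorm nu q%:E (EFin \o (g : borel X -> R)) < +oo)%E.
  move=> ?; apply: le_lt_trans (Lnorm_le_G_norm _ _ psi2_gt0 _) _ => //.
  by rewrite lte_mul_pinfty// ?ltry// ge0_fin_numE.
split.
(* For almost everywhere integrability, one choice of p and q is enough. *)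
- pose p := (a1 + b1) / 2; pose q := (a2 + b2) / 2.
  have p_in : oo_itv a1 b1%:E p by split; rewrite ?lte_fin /p; lra.
  have q_in : oo_itv a2 b2%:E q by split; rewrite ?lte_fin /q; lra.
  have [p_gt1 q_gt1] := (gt1 _ _ _ a1_ge1 p_in, gt1 _ _ _ a2_ge1 q_in).
  have pq : 1 < p^-1 + q^-1.
    have [p_gt0 q_gt0] : 0 < p /\ 0 < q by split; lra.
    have [[_ pb] [_ qb]] := (p_in, q_in); move: pb qb; rewrite !lte_fin => pb qb.
    by apply: lt_trans b12 _; apply: ltrD; rewrite ltf_pV2.
  apply: (@ae_integrable_convolution _ _ _ nu f g mf mg mu_uni mu_neq0
    p q (p^-1 + q^-1 - 1)^-1) => //; [|by rewrite invrK; ring|exact: Lf_lty|exact: Lg_lty].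
  by rewrite invr_gt0 subr_gt0.
- exact: (@measurable_convolution _ _ _ nu).
- apply: ge_ereal_sup => _ [r [Ar rB] <-].
  have [r_gt0 [p [q [p_in q_in pqr]]]] :=
    exists_young_exponents a1_ge1 a2_ge1 ab1 ab2 a12 b12 Ar rB.
  rewrite /tau_weight; set E := (X in inf X).
  have E_neq0 : E !=set0.
    exists (psi1 p * psi2 q), p, q.
    by split=> //; split=> //; [exact: gt1 p_in|exact: gt1 q_in].
  have tau_gt0 : 0 < inf E.
    apply: lt_le_trans (mulr_gt0 c1_gt0 c2_gt0) _; apply: lb_le_inf => //.
    move=> _ [p' [q' [[p'_in _] [q'_in _] _ ->]]].
    by apply: ler_pM; [exact: ltW|exact: ltW|exact: c1P|exact: c2P].
  set N := Lnorm _ _ _; set Mf := G_norm _ _ _ _ f; set Mg := G_norm _ _ _ _ g.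
  have young_N s : E s -> (N <= Mf * Mg * s%:E)%E.
    move=> [p' [q' [[p'_in p'_gt1] [q'_in q'_gt1] p'q'r ->]]].
    apply: le_trans (@young_convolution _ _ _ nu _ _ mf mg mu_uni mu_neq0 _ _ _
      p'_gt1 q'_gt1 r_gt0 p'q'r) _.
    rewrite EFinM muleACA; apply: lee_pmul; rewrite ?Lnorm_ge0//.
      exact: Lnorm_le_G_norm.
    exact: Lnorm_le_G_norm.
  have [Mf_fin Mg_fin] : Mf \is a fin_num /\ Mg \is a fin_num.
    by rewrite !ge0_fin_numE.
  rewrite inver gt_eqF// lee_pdivrMr//.
  have [s0 Es0] := E_neq0.
  have N_fin : N \is a fin_num.
    rewrite ge0_fin_numE ?Lnorm_ge0//; apply: le_lt_trans (young_N _ Es0) _.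
    by rewrite ltey_eq !fin_numM.
  have M_ge0 : 0 <= fine Mf * fine Mg by rewrite mulr_ge0 ?fine_ge0.
  move: young_N; rewrite -(fineK N_fin) -(fineK Mf_fin) -(fineK Mg_fin).
  rewrite -!EFinM !lee_fin => young_N.
  have [M0|MN0] := eqVneq (fine Mf * fine Mg) 0.
    by rewrite M0 mul0r; have := young_N _ Es0; rewrite lee_fin M0 mul0r.
  have M_gt0 : 0 < fine Mf * fine Mg by rewrite lt0r MN0.
  rewrite mulrC -ler_pdivrMr//; apply: lb_le_inf => // s Es.
  by rewrite ler_pdivrMr// mulrC; have := young_N _ Es; rewrite lee_fin.
Qed.
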